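(* There are absolute constants $c_1 > 0$ and $c_2 > 0$ such that $$c_1 \left(\frac nk\right)^{1/2} \leq \min_{P \in \mathcal{P}_{n,k}}\frac{\|P'(x)\sqrt{1-x^2}\|_{[0,1]}}{V_0^1(P)} \leq \min_{P \in \mathcal{P}_{n,k}}\frac{\|P'(x)\sqrt{1-x^2}\|_{[0,1]}}{|P(1)|} \leq c_2 \left( \frac nk + 1 \right)^{1/2}$$ for all integers $n \geq 1$ and $k \geq 1$. Here $c_1 = 1/6$ is a suitable choice.
   Context: For an integer $m \ge 0$, $\mathcal{P}_m$ denotes the set of all algebraic polynomials of degree at most $m$ with real coefficients. For integers $n,k \ge 1$, $\mathcal{P}_{n,k}$ is the set of all polynomials $P$ of degree at most $n+k$ with a zero at $0$ of order $n+1$, i.e. of the form $P(x) = x^{n+1}R(x)$ with $R \in \mathcal{P}_{k-1}$, $R$ not identically zero. For a real-valued function $f$ defined on a set $A \subset \mathbb{R}$, $\|f\|_A := \sup_{x \in A}|f(x)|$; thus $\|P'(x)\sqrt{1-x^2}\|_{[0,1]} = \sup_{x\in[0,1]} |P'(x)|\sqrt{1-x^2}$. For a continuously differentiable function $f$ on $[a,b]$, $V_a^b(f) := \int_a^b |f'(x)|\,dx$ is its total variation. A quotient with zero denominator $|P(1)| = 0$ (and nonzero numerator) is interpreted as $+\infty$. ''Absolute constants'' means that $c_1, c_2$ do not depend on $n$ or $k$. *)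

(* Defs.v *)
From mathcomp Require Import all_boot all_order all_algebra.
From mathcomp Require Import all_classical all_reals all_analysis.

Set Implicit Arguments.
Unset Strict Implicit.
Unset Printing Implicit Defensive.

Import Order.TTheory GRing.Theory Num.Theory.
Import numFieldNormedType.Exports.

Local Open Scope classical_set_scope.
Local Open Scope ring_scope.

(* Polynomials of degree at most m: [size p] is the degree plus one. *)
Definition polys_deg_le (R : realType) (m : nat) : set {poly R} :=
  [set p : {poly R} | (size p <= m.+1)%N].

Definition polys_zero_at_0 (R : realType) (n k : nat) : set {poly R} :=
  [set p : {poly R} | exists q : {poly R},
     [/\ polys_deg_le k.-1 q, q != 0 & p = 'X^(n.+1) * q]].

(* Extended-real valued, so that no boundedness is presupposed. *)
Definition sup_norm (R : realType) (A : set R) (f : R -> R) : \bar R :=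
  ereal_sup [set (`|f x|)%:E | x in A].

Definition variation_integral (R : realType) (a b : R) (f : R -> R) : \bar R :=
  (\int[@lebesgue_measure R]_(x in `[a, b]) (`|derive1 f x|)%:E)%E.

Definition weighted_deriv_norm (R : realType) (p : {poly R}) : \bar R :=
  sup_norm `[0, 1] (fun x => (deriv p).[x] * Num.sqrt (1 - x ^+ 2)).

Definition is_min (R : realType) (A : set (\bar R)) (m : \bar R) : Prop :=
  A m /\ lbound A m.

(* In [\bar R] the inverse of 0 is +oo, so a quotient with positive numerator
   and zero denominator is +oo. *)
Definition variation_quotients (R : realType) (n k : nat) : set (\bar R) :=
  [set (weighted_deriv_norm p / variation_integral 0 1 (horner p))%E
     | p in @polys_zero_at_0 R n k].

Definition endpoint_quotients (R : realType) (n k : nat) : set (\bar R) :=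
  [set (weighted_deriv_norm p / (`|p.[1]|)%:E)%E
     | p in @polys_zero_at_0 R n k].

(* Main.v *)
Require Import Defs.
From mathcomp Require Import all_boot all_order all_algebra.
From mathcomp Require Import all_classical all_reals all_analysis.
From mathcomp Require Import qpoly measurable_realfun ring lra zify.
Import Order.TTheory GRing.Theory Num.Theory.
Import numFieldNormedType.Exports.
Local Open Scope classical_set_scope.
Local Open Scope ring_scope.

Set Implicit Arguments.
Unset Strict Implicit.
Unset Printing Implicit Defensive.

(** Write [p = x^(n+1) q], [N = sup_[0,1] |p'(x)| sqrt(1-x^2)] and [s = k/n].

    Minima. The admissible polynomials are the nonzero vectors of a space of
    dimension [k]. On it [N] is a norm, and the two denominators, total
    variation and [|p(1)|], are seminorms. Seminorms are continuous and
    homogeneous, so [denominator / N] reaches a maximum on the unit sphere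
    ([seminorm_ratio_max], [extremal_quotient]).

    Middle inequality. [|p(1)| = |p(1) - p(0)|] is at most the variation.

    Lower bound. Since [sqrt(1-x^2) >= sqrt(1-x)], the derivative satisfies
    [|p'(x)| <= N / sqrt(1-x)], so the variation over [[c,1]] is at most
    [2 N sqrt(1-c)]. If [8 s >= 1], then [c = 0] already suffices. If [8 s < 1],
    then [c = 1 - 8 s] is taken and little variation is left over [[0,c]]:
    [p' = x^n S] with [deg S < k], and [x^n] wins against the growth of [S].
    Indeed [S] is controlled on [[1-5s, 1-s]], it grows to the left of this
    interval at most like a power [k-1] of the distance ([growth_left_of_itv],
    Lagrange interpolation), while [x^n] decays like [exp(-k z)] at distance
    [z s]. The net decay [exp(-z)] ([incomplete_decay]) makes the integral over
    [[0,c]] at most [N sqrt(s) / 4]. The total is at most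
    [(2 sqrt 8 + 1/4) N sqrt s <= 6 N sqrt s] ([variation_le]).

    Upper bound. A polynomial whose variation spreads evenly over
    [1 - x <= C k/n] is needed. The incomplete beta function
    [x^(n+1) sum_(i <= j) C(n+i,n) (1-x)^i] climbs from 0 to 1 around
    [1 - x = j/(n+j)], so the sum of these over [j < k] is such a polynomial.
    With [t = 1 - x], its derivative [D] is a sum of negative binomial weights,
    which give both [D <= 2 (n+k)] and [t D <= 2 k] when [k <= n]; the product
    of the two bounds controls [D^2 (1 - x^2)] ([endpoint_extremal]). For
    [k > n] the polynomial for [k = n] is admissible and good enough. *)

(** * Integrals of absolute values *)

Lemma integrable_continuous_itv (R : realType) (f : R -> R) (a b : R) :
  continuous f -> (@lebesgue_measure R).-integrable `[a, b] (EFin \o f).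
Proof.
move=> cf; apply: continuous_compact_integrable; first exact: segment_compact.
exact: continuous_subspaceT.
Qed.

(** Only the interior derivative of [G] enters, so [g] may blow up at an endpoint:
    instead of an improper integral, [\int_a^x |f| - G x] is nonincreasing. *)
Lemma integral_norm_le (R : realType) (f G g : R -> R) (a b : R) : a <= b ->
  continuous f -> {within `[a, b], continuous G} ->
  (forall x, x \in `]a, b[ -> is_derive x 1 G (g x)) ->
  (forall x, x \in `]a, b[ -> `|f x| <= g x) ->
  (\int[@lebesgue_measure R]_(x in `[a, b]) `|f x|%:E <= (G b - G a)%:E)%E.
Proof.
rewrite le_eqVlt => /predU1P[<- *|ab cf cG dG fg].
  by rewrite set_itv1 integral_set1 subrr.
have cnf : continuous (fun x => `|f x|).
  by move=> x; apply: (continuous_comp (cf x)); exact: norm_continuous.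
have nfi c d := integrable_continuous_itv c d cnf.
pose H x := parameterized_integral (@lebesgue_measure R) a x (fun x => `|f x|).
have HbE : (\int[@lebesgue_measure R]_(x in `[a, b]) `|f x|%:E)%E = (H b)%:E.
  rewrite /H /parameterized_integral /Rintegral fineK //.
  exact: integrable_fin_num (nfi a b).
have Ha : H a = 0.
  by rewrite /H /parameterized_integral set_itv1 Rintegral_set1.
have cH : {within `[a, b], continuous H}.
  apply: parameterized_integral_continuous => //; exact: ltW.
have dH x : x \in `]a, b[ -> is_derive x 1 H `|f x|.
  rewrite in_itv /= => /andP[ax xb].
  have [d e] := continuous_FTC1_closed xb (nfi a b) ax (cnf x).
  by rewrite -e derive1E; exact/derivableP.
suff : (H - G) b <= (H - G) a.
  rewrite HbE lee_fin; change (H b - G b <= H a - G a -> H b <= G b - G a).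
  by rewrite Ha; lra.
apply: (@ler0_derive1_le_cc _ (H - G) a b); last 4 first.
- by move=> x; exact/continuousB/cG/cH.
- by rewrite in_itv /= lexx ltW.
- by rewrite in_itv /= lexx ltW.
- exact: ltW.
- move=> x xab; apply: derivableB; [by have [] := dH x xab|by have [] := dG x xab].
- move=> x xab; rewrite derive1E; have ? := dH x xab; have ? := dG x xab.
  by rewrite derive_val subr_le0 fg.
Qed.

(** The bound is the increment of [- 2 N sqrt(1-x)], a primitive of [N / sqrt(1-x)]. *)
Lemma integral_le_near1 (R : realType) (f : R -> R) (N c : R) :
  continuous f -> 0 <= c <= 1 -> (forall y, 0 <= y < 1 -> `|f y| <= N / Num.sqrt (1 - y)) ->
  (\int[@lebesgue_measure R]_(x in `[c, 1%R]) `|f x|%:E <= (2 * N * Num.sqrt (1 - c))%:E)%E.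
Proof.
move=> cf /andP[c0 c1] fN; pose G x := - (2 * N * Num.sqrt (1 - x)).
have -> : 2 * N * Num.sqrt (1 - c) = G 1 - G c.
  by rewrite /G subrr sqrtr0 mulr0 oppr0 sub0r opprK.
apply: (@integral_norm_le _ f G (fun x => N / Num.sqrt (1 - x))) => [//|//|||].
- have cl : continuous (fun x : R => 1 - x).
    by move=> x; apply: cvgB; [exact: cvg_cst|exact: cvg_id].
  have cs : continuous (fun x : R => Num.sqrt (1 - x)).
    by move=> x; exact: (continuous_comp (cl x) (@sqrt_continuous _ _)).
  apply: continuous_subspaceT => x; apply: cvgN.
  by apply: (@cvgM _ _ _ _ (cst (2 * N)) _ _ _ (cvg_cst _) (cs x)).
- move=> x; rewrite in_itv /= => /andP[cx x1].
  have d0 : 0 < 1 - x by rewrite subr_gt0.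
  have := is_derive1_sqrt d0 => ds.
  have dl : is_derive x 1 (fun x : R => 1 - x) (-1).
    by apply: is_derive_eq; rewrite add0r mul1r.
  have dc : is_derive x 1 (fun x : R => Num.sqrt (1 - x))
      ((2 * Num.sqrt (1 - x))^-1 * -1).
    exact: (@is_derive1_comp _ Num.sqrt (fun x => 1 - x) x _ _ ds dl).
  rewrite /G; apply: is_derive_eq.
  by rewrite /GRing.scale /=; field; rewrite lt0r_neq0 ?sqrtr_gt0.
- move=> x; rewrite in_itv /= => /andP[cx x1]; apply: fN.
  by rewrite x1 (le_trans c0) // ltW.
Qed.

Lemma measurable_EFin_norm (R : realType) (f : R -> R) (D : set R) :
  continuous f -> measurable D -> measurable_fun D (fun x => (`|f x|)%:E : \bar R).
Proof.
move=> cf mD; apply/measurable_EFinP; apply: measurable_funTS.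
by apply: measurableT_comp; [exact: normr_measurable|exact: continuous_measurable_fun].
Qed.

Lemma integral_itv_split (R : realType) (f : R -> R) (a b c : R) :
  continuous f -> a <= b -> b <= c ->
  (\int[@lebesgue_measure R]_(x in `[a, c]) `|f x|%:E <=
   \int[@lebesgue_measure R]_(x in `[a, b]) `|f x|%:E +
   \int[@lebesgue_measure R]_(x in `[b, c]) `|f x|%:E)%E.
Proof.
move=> cf ab bc.
have mf D := @measurable_EFin_norm R f D cf.
rewrite (@itv_bndbnd_setU _ _ (BLeft a) (BRight b)) ?bnd_simp //.
rewrite ge0_integral_setU //; last 2 first.
- by apply: mf; exact: measurableU.
- apply/disj_set2P; rewrite -subset0 => x []; rewrite /= !in_itv /=.
  by move=> /andP[_ xb] /andP[bx _]; move: xb; rewrite leNgt bx.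
rewrite leeD2l // ge0_subset_integral //; first exact: mf.
by apply: subset_itvr; rewrite bnd_simp.
Qed.

Lemma integral_exp_tail (R : realType) (f : R -> R) (K s a c : R) :
  continuous f -> 0 < s -> 0 <= K -> 0 <= c ->
  (forall x, 0 <= x <= c -> `|f x| <= K * expR ((x - a) / s)) ->
  (\int[@lebesgue_measure R]_(x in `[0%R, c]) `|f x|%:E <= (K * s * expR ((c - a) / s))%:E)%E.
Proof.
move=> cf s0 K0 c0 fK; pose G x := K * s * expR ((x - a) / s).
have dG (x : R) : is_derive x 1 G (K * expR ((x - a) / s)).
  have dl : is_derive x 1 (fun x : R => (x - a) / s) s^-1.
    by apply: is_derive_eq; rewrite subr0 scaler0 add0r /GRing.scale /= mulr1.
  have dc := @is_derive1_comp _ expR (fun x => (x - a) / s) x _ _ (is_derive_expR _) dl.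
  have dc' : is_derive x 1 (fun x => expR ((x - a) / s)) (expR ((x - a) / s) * s^-1).
    exact: dc.
  rewrite /G; apply: is_derive_eq.
  by rewrite /GRing.scale /=; field; rewrite lt0r_neq0.
apply: le_trans (_ : (G c - G 0)%:E <= _)%E; last first.
  by rewrite lee_fin lerBlDr lerDl /G !mulr_ge0 ?expR_ge0 // ltW.
apply: (@integral_norm_le _ f G (fun x => K * expR ((x - a) / s))) => [//|//||].
- apply: continuous_subspaceT => x; apply: differentiable_continuous.
  by apply/derivable1_diffP; have [] := dG x.
- by move=> x; rewrite in_itv /= => /andP[x0 xc]; apply: fK; rewrite !ltW.
Qed.

(** * Growth of a polynomial outside an interval *)

(** From [expR (-1/6) >= 5/6] and [(6/5)^6 < 3]. *)
Lemma expR1_le3 (R : realType) : expR 1 <= 3 :> R.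
Proof.
have h : expR (1 / 6) <= 6 / 5 :> R.
  have := expR_ge1Dx (- (1 / 6) : R); rewrite expRN => h.
  have e0 := expR_gt0 (1 / 6 : R).
  by rewrite -[(expR _)^-1]div1r ler_pdivlMr // in h; lra.
rewrite (_ : 1 = 1 / 6 * 6%:R :> R); last by field.
rewrite expRM_natr; apply: le_trans (_ : (6 / 5) ^+ 6 <= _).
  by apply: lerXn2r; rewrite ?nnegrE ?expR_ge0 //; lra.
lra.
Qed.

(** [d^d / d!] is one term of the exponential series at [d]. *)
Lemma exp_fact_bound (R : realType) (d : nat) : (d%:R : R) ^+ d <= 3 ^+ d * d`!%:R.
Proof.
case: d => [|d]; first by rewrite !expr0 fact0 mulr1.
have d0 : 0 <= d.+1%:R :> R by [].
have f0 : 0 < d.+1`!%:R :> R by rewrite ltr0n fact_gt0.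
rewrite -ler_pdivrMr //; apply: le_trans (_ : expR d.+1%:R <= _).
  by apply: le_trans (expR_ge1Dxn d d0); rewrite lerDr.
rewrite -[d.+1%:R]mul1r expRM_natr.
by apply: lerXn2r; rewrite ?nnegrE ?expR_ge0 ?expR1_le3.
Qed.

(** The denominators of the Lagrange basis at equally spaced nodes. *)
Lemma prod_dist_ord (R : numDomainType) (d : nat) (j : 'I_d.+1) :
  \prod_(i < d.+1 | i != j) `|i%:R - j%:R : R| = j`!%:R * (d - j)`!%:R.
Proof.
rewrite (bigID (fun i : 'I_d.+1 => (i < j)%N)) /=; congr (_ * _).
  rewrite fact_prod natr_prod.
  transitivity (\prod_(0 <= i < j) (j - i)%:R : R).
    transitivity (\prod_(i < d.+1 | (i < j)%N) (j - i)%:R : R).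
      apply: eq_big => [i|i /andP[_ ij]].
        by rewrite andb_idl // => ij; rewrite neq_ltn ij.
      by rewrite distrC natrB ?(ltnW ij) // ger0_norm // subr_ge0 ler_nat ltnW.
    by rewrite -(big_ord_widen _ (fun i => (j - i)%:R : R)) ?big_mkord // ltnW.
  rewrite big_nat_rev /= add0n big_add1 /=.
  by apply: eq_big_nat => i /andP[_ ij]; congr (_%:R); lia.
rewrite fact_prod natr_prod.
transitivity (\prod_(j.+1 <= i < d.+1) (i - j)%:R : R); last first.
  rewrite -[j.+1]add1n big_addn (_ : (d.+1 - j = (d - j).+1)%N); last first.
    by have := ltn_ord j; lia.
  by apply: eq_big_nat => i _; congr (_%:R); lia.
rewrite big_geq_mkord.
apply: eq_big => [i|i /andP[_ ij]]; last first.
  rewrite -leqNgt in ij.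
  by rewrite natrB // ger0_norm // subr_ge0 ler_nat.
by rewrite -leqNgt -val_eqE /=; case: ltngtP.
Qed.

Lemma sum_inv_fact (R : numFieldType) (d : nat) :
  \sum_(j < d.+1) (j`!%:R * (d - j)`!%:R)^-1 = 2 ^+ d / d`!%:R :> R.
Proof.
apply: (@mulIf _ d`!%:R); first by rewrite pnatr_eq0 -lt0n fact_gt0.
rewrite mulfVK ?pnatr_eq0 -?lt0n ?fact_gt0 // mulr_suml.
rewrite -natrX -[X in (X ^ _)%N]/(1 + 1)%N expnDn natr_sum.
apply: eq_bigr => j _; rewrite !exp1n !muln1.
have jd : (j <= d)%N by rewrite -ltnS.
by rewrite -(bin_fact jd) !natrM mulrC -mulrA mulfV ?mulr1.
Qed.

(** Lagrange interpolation at the [d+1] equally spaced nodes of [[a,b]]: every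
    factor [|x - t j|] is at most [b - x], and with the spacing [h = (b-a)/d]
    the denominators are [h^d i! (d-i)!]. Their inverses add up to
    [(2d)^d / (d! (b-a)^d)], and [d^d / d! <= 3^d]. *)
Lemma growth_left_of_itv (R : realType) (S : {poly R}) (d : nat) (M a b x : R) :
  (size S <= d.+1)%N -> a < b -> x <= a ->
  (forall y, a <= y <= b -> `|S.[y]| <= M) ->
  `|S.[x]| <= M * (6 * (b - x) / (b - a)) ^+ d.
Proof.
move=> sS ab xa SM.
have M0 : 0 <= M by apply: le_trans (normr_ge0 _) (SM a _); rewrite lexx ltW.
case: d sS => [|d] sS.
  have := SM a; rewrite expr0 mulr1 (size1_polyC sS) !hornerC; apply.
  by rewrite lexx ltW.
set m := d.+1 in sS *.
have m0 : 0 < m%:R :> R by rewrite ltr0n.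
pose h := (b - a) / m%:R.
have h0 : 0 < h by rewrite divr_gt0 // subr_gt0.
pose t (i : nat) := a + i%:R * h.
have tinj : injective t.
  move=> i j /addrI /(mulIf (lt0r_neq0 h0)) /eqP; rewrite eqr_nat; exact/eqP.
have tab (i : 'I_m.+1) : a <= t i <= b.
  have ih : i%:R * h <= b - a.
    rewrite /h mulrCA ler_piMr ?subr_ge0 //; first exact: ltW.
    by rewrite ler_pdivrMr // mul1r ler_nat -ltnS.
  have : 0 <= i%:R * h by rewrite mulr_ge0 // ltW.
  by rewrite /t; lra.
rewrite [in leLHS](lagrange_gen (ltn0Sn m) tinj sS) horner_sum.
apply: le_trans (ler_norm_sum _ _ _) _.
have key (i : 'I_m.+1) : `|(S.[t i]%:P * tnth (lagrange m.+1 t) i).[x]| <=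
    M * ((b - x) / h) ^+ m * (i`!%:R * (m - i)`!%:R)^-1.
  rewrite hornerM hornerC normrM -mulrA ler_pM ?normr_ge0 ?SM ?tab //.
  rewrite (lagrangeE (ltn0Sn m) tinj) hornerM hornerC normrM normfV.
  rewrite !horner_prod !normr_prod.
  have -> : \prod_(j < m.+1 | j != i) `|('X - (t j)%:P).[t i]| =
      h ^+ m * (i`!%:R * (m - i)`!%:R).
    under eq_bigr => j _.
      rewrite hornerXsubC (_ : _ - _ = (i%:R - j%:R) * h); last by rewrite /t; ring.
      rewrite normrM distrC (ger0_norm (ltW h0)); over.
    rewrite big_split /= prod_dist_ord prodr_const cardC1 card_ord mulrC //.
  have prod_le : \prod_(j < m.+1 | j != i) `|('X - (t j)%:P).[x]| <= (b - x) ^+ m.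
    have -> : (b - x) ^+ m = \prod_(j < m.+1 | j != i) (b - x).
      by rewrite prodr_const cardC1 card_ord.
    apply: ler_prod => j _; rewrite normr_ge0 hornerXsubC /= distrC.
    have /andP[aj jb] := tab j; rewrite ger0_norm ?subr_ge0 ?lerD2r //.
    exact: le_trans aj.
  rewrite mulrC [((b - x) / h) ^+ m]expr_div_n -[leRHS]mulrA -[X in _ <= _ * X]invfM ler_wpM2r //.
  rewrite invr_ge0.
  by rewrite !mulr_ge0 // exprn_ge0 // ltW.
apply: le_trans (ler_sum _ (fun i _ => key i)) _.
rewrite -mulr_sumr sum_inv_fact -[leLHS]mulrA ler_wpM2l //.
have -> : (b - x) / h = (b - x) / (b - a) * m%:R.
  by rewrite /h invf_div mulrCA mulrC.
rewrite -mulrA mulrC.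
have -> : 6 * (b - x) / (b - a) = (b - x) / (b - a) * (3 * 2) by ring.
have fm0 : 0 < m`!%:R :> R by rewrite ltr0n fact_gt0.
rewrite !exprMn mulrC -!mulrA ler_wpM2l ?exprn_ge0 //; first by lra.
rewrite ler_wpM2l ?exprn_ge0 ?invr_ge0 //; first by lra.
by rewrite mulrCA mulrC ler_wpM2r ?exprn_ge0 // ler_pdivrMr // exp_fact_bound.
Qed.

(** * The variation of a polynomial with a high order zero at 0 *)

Lemma deriv_zero_at_0 (R : comNzRingType) (n k : nat) (q : {poly R}) :
  (0 < k)%N -> (size q <= k)%N -> exists2 S : {poly R}, (size S <= k)%N &
  deriv ('X^(n.+1) * q) = 'X^n * S.
Proof.
move=> k0 sq; exists (q *+ n.+1 + 'X * deriv q); last first.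
  by rewrite derivM derivXn mulrDr mulrA -exprSr mulrnAl mulrnAr.
have [->|q0] := eqVneq q 0; first by rewrite mul0rn deriv0 mulr0 addr0 size_poly0.
apply: leq_trans (size_polyD _ _) _; rewrite geq_max; apply/andP; split.
  by rewrite -scaler_nat (leq_trans (size_scale_leq _ _)).
apply: leq_trans (size_polyMleq _ _) _; rewrite size_polyX /=.
exact: leq_trans (lt_size_deriv q0) _.
Qed.

(** [expR z >= (1 + z/6)^6], and four of the six factors are at least [3/2]. *)
Lemma linear_le_expR (R : realType) (z : R) : 3 <= z -> 6 + 3 / 2 * z <= expR z.
Proof.
move=> z3; have := expR_ge1Dx (z / 6) => h.
rewrite (_ : z = z / 6 * 6%:R); last by field.
rewrite expRM_natr; apply: le_trans (_ : (1 + z / 6) ^+ 6 <= _); last first.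
  by apply: lerXn2r; rewrite ?nnegrE ?expR_ge0 //; lra.
set w := z / 6 in h *; have w1 : 1 / 2 <= w by rewrite /w; lra.
have : (9 / 4) ^+ 2 * (1 + w) ^+ 2 <= (1 + w) ^+ 6.
  rewrite -[6%N]/(4 + 2)%N exprD ler_wpM2r ?sqr_ge0 // -[4%N]/(2 * 2)%N exprM.
  by apply: lerXn2r; rewrite ?nnegrE; nra.
apply: le_trans; nra.
Qed.

(** At distance [z s] to the left of [1 - 5 s], with [z >= 3], the polynomial [S]
    has gained at most [(6 + 3z/2)^(k-1) <= exp(z)^(k-1)], and [x^n] has lost
    [exp(-k z)]. *)
Lemma incomplete_decay (R : realType) (n k : nat) (S : {poly R}) (N s x : R) :
  (0 < k)%N -> (size S <= k)%N -> s * n%:R = k%:R -> 0 < s -> 8 * s <= 1 ->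
  (forall y, 0 <= y < 1 -> `|y ^+ n * S.[y]| <= N / Num.sqrt (1 - y)) ->
  0 <= x <= 1 - 8 * s ->
  `|x ^+ n * S.[x]| <= N / Num.sqrt s * expR ((x - (1 - 5 * s)) / s).
Proof.
move=> k0 sS sn s0 s8 SN /andP[x0 xc].
have N0 : 0 <= N.
  by have := SN 0; rewrite lexx ltr01 subr0 sqrtr1 divr1 => /(_ isT); apply: le_trans.
set a := 1 - 5 * s; pose b := 1 - s.
have a0 : 0 < a by rewrite /a; lra.
have ab : a < b by rewrite /a /b; lra.
have an0 : 0 < a ^+ n by rewrite exprn_gt0.
have rs0 : 0 < Num.sqrt s by rewrite sqrtr_gt0.
have SM y : a <= y <= b -> `|S.[y]| <= N / Num.sqrt s / a ^+ n.
  move=> /andP[ay yb]; rewrite ler_pdivlMr // mulrC.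
  have y0 : 0 < y by exact: lt_le_trans ay.
  apply: le_trans (_ : y ^+ n * `|S.[y]| <= _).
    by rewrite ler_wpM2r // lerXn2r ?nnegrE // ltW.
  have := SN y; rewrite normrM ger0_norm ?exprn_ge0 ?(ltW y0) //.
  have y1 : y < 1 by rewrite /b in yb; lra.
  rewrite y1 => /(_ isT)/le_trans; apply.
  have sy : s <= 1 - y by rewrite /b in yb; lra.
  rewrite ler_wpM2l // lef_pV2 ?posrE ?sqrtr_gt0 ?ler_wsqrtr //.
  exact: lt_le_trans sy.
have xa : x <= a by rewrite /a; lra.
have := growth_left_of_itv (d := k.-1) _ ab xa SM; rewrite prednK // => /(_ sS) Sx.
pose z := (a - x) / s.
have z3 : 3 <= z by rewrite /z ler_pdivlMr // /a; lra.
have uE : 6 * (b - x) / (b - a) = 6 + 3 / 2 * z.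
  by rewrite /z /a /b; field; rewrite ?lt0r_neq0 //; lra.
have Sx' : `|S.[x]| <= N / Num.sqrt s / a ^+ n * expR z ^+ k.-1.
  apply: le_trans Sx _; rewrite uE ler_wpM2l //.
    by rewrite !divr_ge0 // ltW.
  by apply: lerXn2r; rewrite ?nnegrE ?expR_ge0 ?linear_le_expR //; lra.
have xn : x ^+ n <= a ^+ n * expR (- z) ^+ k.
  have h : x <= a * expR (x - a).
    apply: le_trans (_ : a * (1 + (x - a)) <= _); last first.
      by rewrite ler_wpM2l ?expR_ge1Dx // ltW.
    (* The difference is [(1 - a) (a - x)]. *)
    rewrite /a; nra.
  apply: le_trans (_ : (a * expR (x - a)) ^+ n <= _).
    by apply: lerXn2r => //; rewrite nnegrE // mulr_ge0 ?expR_ge0 // ltW.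
  rewrite exprMn -!expRM_natr.
  suff -> : (x - a) * n%:R = - z * k%:R by [].
  by rewrite -sn /z; field; rewrite lt0r_neq0.
rewrite normrM ger0_norm ?exprn_ge0 //.
apply: le_trans (ler_pM _ _ xn Sx') _; rewrite ?exprn_ge0 //.
have -> : (x - a) / s = - z by rewrite /z; ring.
have -> : a ^+ n * expR (- z) ^+ k * (N / Num.sqrt s / a ^+ n * expR z ^+ k.-1)
   = N / Num.sqrt s * (expR (- z) ^+ k * expR z ^+ k.-1).
  by field; rewrite !lt0r_neq0.
rewrite ler_wpM2l //; first by rewrite divr_ge0 // ltW.
rewrite -{1}(prednK k0) exprS -mulrA -exprMn expRN mulVf ?expr1n ?mulr1 //.
by rewrite lt0r_neq0 ?expR_gt0.
Qed.

Lemma variation_le (R : realType) (n k : nat) (q : {poly R}) (N : R) :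
  (0 < n)%N -> (0 < k)%N -> (size q <= k)%N ->
  (forall x, 0 <= x <= 1 ->
    `|(deriv ('X^(n.+1) * q)).[x] * Num.sqrt (1 - x ^+ 2)| <= N) ->
  (\int[@lebesgue_measure R]_(x in `[0%R, 1%R])
     `|(deriv ('X^(n.+1) * q)).[x]|%:E <= (6 * Num.sqrt (k%:R / n%:R) * N)%:E)%E.
Proof.
move=> n0 k0 sq pN; set f := horner (deriv _) in pN *.
have cf : continuous f by exact: continuous_horner.
have nr0 : 0 < n%:R :> R by rewrite ltr0n.
have kr0 : 0 < k%:R :> R by rewrite ltr0n.
have N0 : 0 <= N by apply: le_trans (pN 0 _); rewrite ?lexx ?ler01.
have fN y : 0 <= y < 1 -> `|f y| <= N / Num.sqrt (1 - y).
  move=> /andP[y0 y1]; rewrite ler_pdivlMr ?sqrtr_gt0 ?subr_gt0 //.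
  apply: le_trans (pN y _); last by rewrite y0 ltW.
  rewrite normrM ler_wpM2l // [leRHS]ger0_norm ?sqrtr_ge0 // ler_wsqrtr //; nra.
set s : R := k%:R / n%:R.
have s0 : 0 < s by rewrite divr_gt0.
have rs0 : 0 < Num.sqrt s by rewrite sqrtr_gt0.
have rs2 : Num.sqrt s ^+ 2 = s by rewrite sqr_sqrtr // ltW.
have [s8|s8] := leP 1 (8 * s).
  apply: le_trans (integral_le_near1 cf _ fN) _; first by rewrite lexx ler01.
  rewrite lee_fin subr0 sqrtr1; set r := Num.sqrt s in rs0 rs2 *.
  have : 1 / 3 <= r by nra.
  nra.
(* The part over [[c,1]] costs [2 sqrt 8 < 23/4], which leaves [1/4] out of 6 for
   the part over [[0,c]]. *)
pose c := 1 - 8 * s.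
have c01 : 0 <= c <= 1 by rewrite /c; lra.
have /andP[c0 c1] := c01.
have [S sS pS] := deriv_zero_at_0 n k0 sq.
have fE y : f y = y ^+ n * S.[y] by rewrite /f pS hornerM hornerXn.
have dec x : 0 <= x <= c -> `|f x| <= N / Num.sqrt s * expR ((x - (1 - 5 * s)) / s).
  move=> xc; rewrite fE; apply: incomplete_decay k0 sS _ s0 _ _ xc.
  - by rewrite /s divfK // lt0r_neq0.
  - exact: ltW.
  - by move=> y y01; rewrite -fE fN.
apply: le_trans (integral_itv_split cf c0 c1) _.
have Ns0 : 0 <= N / Num.sqrt s by rewrite divr_ge0 // ltW.
apply: le_trans (leeD (integral_exp_tail cf s0 Ns0 c0 dec) (integral_le_near1 cf c01 fN)) _.
rewrite -EFinD lee_fin.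
have -> : (c - (1 - 5 * s)) / s = - 3 by rewrite /c; field; rewrite lt0r_neq0.
have -> : 1 - c = 8 * s by rewrite /c; ring.
have -> : N / Num.sqrt s * s = N * Num.sqrt s.
  by rewrite -{2}rs2; field; rewrite lt0r_neq0.
have e3 : expR (- 3) <= 1 / 4 :> R.
  have := expR_ge1Dx (3 : R); rewrite expRN -[_^-1]div1r => h.
  by rewrite ler_pdivrMr ?expR_gt0 //; lra.
have r8 : Num.sqrt 8 <= 23 / 8 :> R.
  by rewrite -[leRHS]ger0_norm ?divr_ge0 // -sqrtr_sqr ler_wsqrtr //; lra.
rewrite (@sqrtrM _ 8 s) //; set r := Num.sqrt s in rs0 *; set e := Num.sqrt 8 in r8 *.
have : N * r * expR (-3) <= N * r * (1 / 4) by rewrite ler_wpM2l // mulr_ge0 // ltW.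
have : N * r * e <= N * r * (23 / 8) by rewrite ler_wpM2l // mulr_ge0 // ltW.
lra.
Qed.

(** * Averaged incomplete beta functions *)

(** Pascal's rule summed against [t^i], with the boundary term kept. *)
Lemma sum_bin_geometric (R : comPzRingType) (n m : nat) (t : R) :
  (1 - t) * \sum_(i < m) 'C(n.+1 + i, n.+1)%:R * t ^+ i
    + 'C(n + m, n.+1)%:R * t ^+ m = \sum_(i < m) 'C(n + i, n)%:R * t ^+ i.
Proof.
elim: m => [|m IHm].
  by rewrite !big_ord0 addn0 bin_small // mulr0 add0r mul0r.
rewrite !big_ord_recr /= -IHm addnS addSn binS natrD exprS; ring.
Qed.

(** The left side is the probability of seeing [n+1] successes before [m] failures
    when a trial succeeds with probability [x]. *)
Lemma negative_binomial_le1 (R : realDomainType) (n m : nat) (x : R) :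
  0 <= x <= 1 -> x ^+ n.+1 * \sum_(i < m) 'C(n + i, n)%:R * (1 - x) ^+ i <= 1.
Proof.
move=> /andP[x0 x1]; have t0 : 0 <= 1 - x by rewrite subr_ge0.
elim: n => [|n IHn].
  have := subrX1 (1 - x) m; rewrite (_ : 1 - x - 1 = - x); last by ring.
  under [X in _ * X <= _]eq_bigr do rewrite bin0 mul1r.
  have := exprn_ge0 m t0; rewrite expr1; lra.
apply: le_trans IHn; rewrite exprSr -mulrA ler_wpM2l ?exprn_ge0 //.
rewrite -[leRHS]sum_bin_geometric subKr lerDl.
by rewrite mulr_ge0 ?exprn_ge0.
Qed.

(** On [[0,1]], [x^(n+1) * beta_poly n j] is a regularised incomplete beta function:
    the probability of [n+1] successes before [j+1] failures when a trial succeeds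
    with probability [x]. *)
Definition beta_poly (R : nzRingType) (n j : nat) : {poly R} :=
  \sum_(i < j.+1) 'C(n + i, n)%:R *: (1 - 'X) ^+ i.

(** The derivative telescopes: only the last summand leaves a term, the
    beta density. *)
Lemma deriv_beta_poly (R : comNzRingType) (n j : nat) :
  deriv ('X^(n.+1) * beta_poly R n j) =
  ((n + j.+1) * 'C(n + j, n))%:R *: ('X^n * (1 - 'X) ^+ j).
Proof.
rewrite /beta_poly; elim: j => [|j IHj].
  by rewrite big_ord1 addn0 addn1 binn muln1 scale1r !expr0 !mulr1 derivXn scaler_nat.
rewrite big_ord_recr /= mulrDr derivD IHj.
rewrite (_ : (n + j.+1) * 'C(n + j, n) = j.+1 * 'C(n + j.+1, n))%N; last first.
  by rewrite !addnS mul_bin_down subSn ?leq_addr // addKn.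
rewrite -scalerAr derivZ derivM derivXn deriv_exp derivB derivX derivC /=.
rewrite -!scaler_nat -!mul_polyC !natrM !polyCM !rmorph_nat !exprS; ring.
Qed.

Lemma size_beta_poly (R : idomainType) (n j : nat) : (size (beta_poly R n j) <= j.+1)%N.
Proof.
apply: (leq_trans (size_sum _ _ _)); apply/bigmax_leqP => i _.
apply: leq_trans (size_scale_leq _ _) _.
apply: leq_trans (size_poly_exp_leq _ _) _.
have -> : size (1 - 'X : {poly R}) = 2%N by rewrite -size_polyN opprB size_XsubC.
by rewrite mul1n.
Qed.

Lemma horner_beta_poly (R : comNzRingType) (n j : nat) (x : R) :
  (beta_poly R n j).[x] = \sum_(i < j.+1) 'C(n + i, n)%:R * (1 - x) ^+ i.
Proof.
rewrite /beta_poly horner_sum; apply: eq_bigr => i _.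
by rewrite hornerZ horner_exp !hornerE.
Qed.

Lemma beta_poly_at1 (R : comNzRingType) (n j : nat) : (beta_poly R n j).[1] = 1.
Proof.
rewrite horner_beta_poly subrr big_ord_recl /= addn0 binn expr0 mulr1 big1 ?addr0 //.
by move=> i _; rewrite expr0n mulr0.
Qed.

(** One factor [x] is missing compared with [negative_binomial_le1]; lowering [n]
    by one costs [(n+i)/n], which is at most 2 as long as [i <= n]. *)
Lemma negative_binomial_shift_le2 (R : realFieldType) (n m : nat) (x : R) :
  (0 < n)%N -> (m <= n.+1)%N -> 0 <= x <= 1 ->
  x ^+ n * \sum_(i < m) 'C(n + i, n)%:R * (1 - x) ^+ i <= 2.
Proof.
case: n => // n _ mn x01.
have /andP[x0 x1] := x01; have t0 : 0 <= 1 - x by rewrite subr_ge0.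
apply: le_trans (_ : 2 * (x ^+ n.+1 * \sum_(i < m) 'C(n + i, n)%:R * (1 - x) ^+ i) <= _).
  rewrite mulrCA ler_wpM2l ?exprn_ge0 // mulr_sumr; apply: ler_sum => i _.
  rewrite mulrA ler_wpM2r ?exprn_ge0 // -natrM ler_nat.
  rewrite -(leq_pmul2l (ltn0Sn n)) addSn -mul_bin_diag /= mulnA leq_mul2r.
  by have := ltn_ord i; lia.
by have := negative_binomial_le1 n m x01; lra.
Qed.

(** [D <= 2 (n+k)] and [(1-x) D <= 2 k] come from [negative_binomial_shift_le2],
    the second one after absorbing [1-x] into the weights by
    [(n+j+1) C(n+j,n) = (j+1) C(n+j+1,n)]. Their product bounds
    [D^2 (1-x^2)] by [8 (n+k) k]. *)
Lemma endpoint_extremal (R : realType) (n k : nat) : (0 < k)%N -> (k <= n)%N ->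
  exists q : {poly R}, [/\ (size q <= k)%N, 0 < q.[1] &
    forall x, 0 <= x <= 1 ->
    `|(deriv ('X^(n.+1) * q)).[x] * Num.sqrt (1 - x ^+ 2)|
      <= Num.sqrt (8 * (n%:R / k%:R + 1)) * q.[1]].
Proof.
move=> k0 kn; pose q : {poly R} := \sum_(j < k) beta_poly R n j.
have q1 : q.[1] = k%:R.
  rewrite horner_sum; under eq_bigr do rewrite beta_poly_at1.
  by rewrite sumr_const card_ord.
have kr0 : 0 < k%:R :> R by rewrite ltr0n.
exists q; rewrite q1; split => // [|x x01].
  apply: (leq_trans (size_sum _ _ _)); apply/bigmax_leqP => i _.
  exact: leq_trans (size_beta_poly _ _ _) _.
have /andP[x0 x1] := x01; have t0 : 0 <= 1 - x by rewrite subr_ge0.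
set D := (deriv _).[x].
have DE : D = x ^+ n * \sum_(j < k) ((n + j.+1) * 'C(n + j, n))%:R * (1 - x) ^+ j.
  rewrite /D mulr_sumr linear_sum /= horner_sum mulr_sumr; apply: eq_bigr => j _.
  rewrite deriv_beta_poly hornerZ hornerM hornerXn horner_exp !hornerE /=.
  by congr (_ * _); rewrite mulrC.
have n0 : (0 < n)%N by exact: leq_trans kn.
have D0 : 0 <= D.
  rewrite DE mulr_ge0 ?exprn_ge0 // sumr_ge0 // => j _.
  by rewrite mulr_ge0 ?exprn_ge0.
have Dle : D <= 2 * (n + k)%:R.
  apply: le_trans (_ : (n + k)%:R * (x ^+ n * \sum_(i < k) 'C(n + i, n)%:R * (1 - x) ^+ i) <= _).
    rewrite DE mulrCA ler_wpM2l ?exprn_ge0 // mulr_sumr; apply: ler_sum => i _.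
    rewrite mulrA ler_wpM2r ?exprn_ge0 // -natrM ler_nat leq_mul2r.
    by rewrite leq_add2l ltn_ord orbT.
  by rewrite mulrC ler_wpM2r // negative_binomial_shift_le2 // ltnW.
have tDle : (1 - x) * D <= 2 * k%:R.
  apply: le_trans (_ : k%:R * (x ^+ n * \sum_(i < k.+1) 'C(n + i, n)%:R * (1 - x) ^+ i) <= _).
    rewrite DE mulrCA [leRHS]mulrCA ler_wpM2l ?exprn_ge0 // big_ord_recl !mulr_sumr.
    rewrite mulrDr ler_wpDl //.
      by rewrite mulr_ge0 // mulr_ge0 ?exprn_ge0.
    rewrite mulr_sumr; apply: ler_sum => i _.
    rewrite mulrCA -exprS mulrA ler_wpM2r ?exprn_ge0 // -natrM ler_nat.
    rewrite lift0 !addnS mul_bin_down subSn ?leq_addr // addKn leq_mul2r.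
    by rewrite ltn_ord orbT.
  by rewrite mulrC ler_wpM2r // negative_binomial_shift_le2.
have s0 : 0 <= 1 - x ^+ 2 by nra.
rewrite ger0_norm ?mulr_ge0 ?sqrtr_ge0 //.
have -> : Num.sqrt (8 * (n%:R / k%:R + 1)) * k%:R = Num.sqrt (8 * (n + k)%:R * k%:R) :> R.
  rewrite -[X in _ * X](ger0_norm (ltW kr0)) -sqrtr_sqr -sqrtrM; last first.
    by rewrite mulr_ge0 // addr_ge0 // divr_ge0.
  by congr Num.sqrt; rewrite natrD; field; rewrite lt0r_neq0.
rewrite -[X in X * _](ger0_norm D0) -sqrtr_sqr -sqrtrM ?sqr_ge0 // ler_wsqrtr //.
have -> : D ^+ 2 * (1 - x ^+ 2) = (1 + x) * (D * ((1 - x) * D)) by ring.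
have : D * ((1 - x) * D) <= (2 * (n + k)%:R) * (2 * k%:R).
  by apply: ler_pM => //; rewrite mulr_ge0.
have : 0 <= D * ((1 - x) * D) by rewrite !mulr_ge0.
set U := D * _; move: U => U; nra.
Qed.

(** * Maximal ratios of seminorms *)

Lemma lipschitz_continuous (R : realType) (V : normedModType R) (F : V -> R) (C : R) :
  0 <= C -> (forall u v, `|F u - F v| <= C * `|u - v|) -> continuous F.
Proof.
move=> C0 FC; have C1 : 0 < C + 1 by rewrite ltr_wpDl.
move=> u; apply/cvgrPdist_le => e e0; near=> v.
apply: le_trans (FC u v) _.
apply: le_trans (_ : (C + 1) * `|u - v| <= _); first by rewrite ler_wpM2r // lerDl.
rewrite mulrC -ler_pdivlMr //; near: v.
by apply: cvgr_dist_le; [exact: cvg_id|rewrite divr_gt0].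
Unshelve. all: by end_near. Qed.

Lemma seminorm_le_mx_norm (R : realType) (m : nat) (F : 'rV[R]_m.+1 -> R) :
  (forall u v, F (u + v) <= F u + F v) -> (forall c u, F (c *: u) = `|c| * F u) ->
  forall u, F u <= (\sum_i F 'e_i) * `|u|.
Proof.
move=> Ftri FZ u; have F0 : F 0 = 0 by rewrite -(scale0r (0 : 'rV_m.+1)) FZ normr0 mul0r.
have Fge0 v : 0 <= F v.
  have := Ftri v (- v); rewrite subrr F0 -scaleN1r FZ normrN1 mul1r; lra.
rewrite [in F u](row_sum_delta u) mulr_suml.
elim/big_rec2: _ => [|i y x _ IH]; first by rewrite F0.
apply: le_trans (Ftri _ _) _; rewrite lerD // FZ mulrC ler_wpM2l //.
rewrite [`|u|]mx_normrE; exact: (le_bigmax _ (fun ij => `|u ij.1 ij.2|) (0, i)).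
Qed.

(** A seminorm is Lipschitz, by the reverse triangle inequality. *)
Lemma seminorm_continuous (R : realType) (m : nat) (F : 'rV[R]_m.+1 -> R) :
  (forall u v, F (u + v) <= F u + F v) -> (forall c u, F (c *: u) = `|c| * F u) ->
  continuous F.
Proof.
move=> Ftri FZ; have Fle := seminorm_le_mx_norm Ftri FZ.
have FN u : F (- u) = F u by rewrite -scaleN1r FZ normrN1 mul1r.
have lip u v : `|F u - F v| <= F (u - v).
  have := Ftri (u - v) v; have := Ftri (v - u) u.
  by rewrite !subrK -(opprB u v) FN ler_norml; lra.
have F0 i : 0 <= F 'e_i by have := le_trans (normr_ge0 _) (lip 'e_i 0); rewrite subr0.
set C := \sum_i F 'e_i in Fle; have C0 : 0 <= C by apply: sumr_ge0.
by apply: (lipschitz_continuous C0) => u v; apply: le_trans (lip u v) (Fle _).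
Qed.

(** [W / N] is invariant under scaling, and continuous on the unit sphere, which is
    compact. *)
Lemma seminorm_ratio_max (R : realType) (m : nat) (N W : 'rV[R]_m.+1 -> R) :
  (forall u v, N (u + v) <= N u + N v) -> (forall c u, N (c *: u) = `|c| * N u) ->
  (forall u, u != 0 -> 0 < N u) ->
  (forall u v, W (u + v) <= W u + W v) -> (forall c u, W (c *: u) = `|c| * W u) ->
  exists2 v, v != 0 & forall u, W u * N v <= W v * N u.
Proof.
move=> Ntri NZ Npos Wtri WZ.
have cN := seminorm_continuous Ntri NZ; have cW := seminorm_continuous Wtri WZ.
pose A := [set u : 'rV[R]_m.+1 | `|u| = 1].
have A0 u : A u -> u != 0.
  move=> Au; apply/eqP => u0; move: Au; rewrite /A /= u0 normr0 => /eqP.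
  by rewrite eq_sym oner_eq0.
have nA u : u != 0 -> A (`|u|^-1 *: u).
  move=> u0; rewrite /A /= normrZ normfV normr_id mulVf //.
  by rewrite normr_eq0.
have Ane : A !=set0.
  exists (`|const_mx 1 : 'rV[R]_m.+1|^-1 *: const_mx 1); apply: nA.
  by apply/eqP => /rowP/(_ 0)/eqP; rewrite !mxE oner_eq0.
have cA : compact A.
  apply: bounded_closed_compact.
    by exists 1; split; [exact: num_real|move=> x x1 u /= ->; exact: ltW].
  apply: (@preimage_closed _ _ (fun u : 'rV[R]_m.+1 => `|u|) [set 1]).
    by move=> u _; exact: norm_continuous.
  exact: closed_eq.
have cWN : {within A, continuous (fun u => W u / N u)}.
  apply: continuous_in_subspaceT => u; rewrite inE => Au.
  have Nu : N u != 0 by rewrite lt0r_neq0 ?Npos ?A0.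
  exact: (cvgM (cW u) (cvgV Nu (cN u))).
have [v + vmax] := EVT_max_rV Ane cA cWN; rewrite inE => Av.
exists v => [|u]; first exact: A0.
have [->|u0] := eqVneq u 0.
  by rewrite -(scale0r (0 : 'rV_m.+1)) WZ NZ normr0 !mul0r mulr0.
have := vmax (`|u|^-1 *: u); rewrite inE => /(_ (nA u u0)).
rewrite WZ NZ invfM mulrACA mulfV ?mul1r; last first.
  by rewrite normr_eq0 invr_eq0 normr_eq0.
by rewrite ler_pdivrMr ?Npos // mulrAC ler_pdivlMr ?Npos ?A0.
Qed.

(** * The weighted norm and the variation as seminorms *)

Definition wnorm (R : realType) (p : {poly R}) : R := fine (weighted_deriv_norm p).

Definition tvar (R : realType) (p : {poly R}) : R := fine (variation_integral 0 1 (horner p)).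

(** The supremum is reached, hence finite, and every property of [wnorm] below
    can be read off at a point where it is reached. *)
Lemma wnormP (R : realType) (p : {poly R}) :
  [/\ weighted_deriv_norm p = (wnorm p)%:E,
    (forall x, 0 <= x <= 1 -> `|(deriv p).[x] * Num.sqrt (1 - x ^+ 2)| <= wnorm p) &
    exists2 c, 0 <= c <= 1 & wnorm p = `|(deriv p).[c] * Num.sqrt (1 - c ^+ 2)|].
Proof.
set g := fun x : R => `|(deriv p).[x] * Num.sqrt (1 - x ^+ 2)|.
have cs : continuous (fun x : R => Num.sqrt (1 - x ^+ 2)).
  have cl : continuous (fun x : R => 1 - x ^+ 2).
    by move=> x; apply: cvgB; [exact: cvg_cst|exact: exprn_continuous].
  by move=> x; exact: (continuous_comp (cl x) (@sqrt_continuous _ _)).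
have cg : continuous g.
  by move=> x; apply: cvg_norm; apply: cvgM; [exact: continuous_horner|exact: cs].
have [c c01 gc] := EVT_max ler01 (continuous_subspaceT cg : {within `[0, 1], continuous g}).
have E : weighted_deriv_norm p = (g c)%:E.
  apply/eqP; rewrite eq_le; apply/andP; split.
    by apply: ge_ereal_sup => _ [x x01 <-]; rewrite lee_fin; exact: gc.
  by apply: ereal_sup_ubound; exists c.
have Ec : wnorm p = g c by rewrite /wnorm E.
rewrite in_itv /= in c01; split; last by exists c.
  by rewrite E Ec.
by move=> x x01; rewrite Ec; apply: gc; rewrite in_itv.
Qed.

Lemma wnormD (R : realType) (p q : {poly R}) : wnorm (p + q) <= wnorm p + wnorm q.
Proof.
have [_ _ [c c01 ->]] := wnormP (p + q).
have [_ Hp _] := wnormP p; have [_ Hq _] := wnormP q.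
by rewrite derivD hornerD mulrDl (le_trans (ler_normD _ _)) // lerD ?Hp ?Hq.
Qed.

Lemma wnormZ (R : realType) (a : R) (p : {poly R}) : wnorm (a *: p) = `|a| * wnorm p.
Proof.
have [_ Hp [c c01 Ec]] := wnormP p; have [_ Ha [d d01 Ed]] := wnormP (a *: p).
apply/eqP; rewrite eq_le; apply/andP; split.
  by rewrite Ed derivZ hornerZ -mulrA normrM ler_wpM2l // Hp.
by have := Ha c c01; rewrite derivZ hornerZ -mulrA normrM -Ec.
Qed.

(** The points [1/(i+2)] lie inside [[0,1]], where the weight is positive, so a zero
    norm would make all of them roots of the derivative. *)
Lemma wnorm_gt0 (R : realType) (p : {poly R}) : deriv p != 0 -> 0 < wnorm p.
Proof.
move=> p0; have [_ Hp [c _ Ec]] := wnormP p.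
have W0 : 0 <= wnorm p by rewrite Ec.
rewrite lt0r W0 andbT; apply: contraNneq p0 => Wp0.
pose rs := [seq (i.+2%:R)^-1 | i <- iota 0 (size (deriv p))] : seq R.
apply: contraT => p0; have := @max_poly_roots _ (deriv p) rs p0.
rewrite size_map size_iota ltnn => H; apply: H; last first.
  rewrite map_inj_uniq ?iota_uniq // => i j /invr_inj /eqP.
  by rewrite eqr_nat => /eqP [].
apply/allP => _ /mapP[i _ ->].
have i2 : 1 < i.+2%:R :> R by rewrite ltr1n.
set x := (i.+2%:R)^-1; have x0 : 0 < x by rewrite invr_gt0.
have x1 : x < 1 by rewrite invf_lt1.
have := Hp x; rewrite (ltW x0) (ltW x1) Wp0 => /(_ isT); rewrite normr_le0 mulf_eq0.
rewrite sqrtr_eq0 => /orP[//|]; nra.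
Qed.

Lemma tvarE (R : realType) (p : {poly R}) :
  variation_integral 0 1 (horner p) = (tvar p)%:E /\
  (\int[@lebesgue_measure R]_(x in `[0%R, 1%R]) `|(deriv p).[x]|%:E)%E = (tvar p)%:E.
Proof.
have E : variation_integral 0 1 (horner p) =
    (\int[@lebesgue_measure R]_(x in `[0%R, 1%R]) `|(deriv p).[x]|%:E)%E.
  by rewrite /variation_integral -derivE.
suff F : variation_integral 0 1 (horner p) = (tvar p)%:E by split; rewrite // -E.
rewrite /tvar fineK // E.
have cn : continuous (fun x => `|(deriv p).[x]|).
  move=> x; apply: (continuous_comp (@continuous_horner _ (deriv p) x)).
  exact: norm_continuous.
exact: integrable_fin_num (integrable_continuous_itv 0 1 cn).
Qed.

Lemma tvarD (R : realType) (p q : {poly R}) : tvar (p + q) <= tvar p + tvar q.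
Proof.
have [_ Ep] := tvarE p; have [_ Eq] := tvarE q; have [_ Epq] := tvarE (p + q).
move: (tvar p) (tvar q) (tvar (p + q)) Ep Eq Epq => a b c Ep Eq Epq.
rewrite -lee_fin EFinD -Ep -Eq -Epq.
have mf (r : {poly R}) :=
  measurable_EFin_norm (@continuous_horner _ (deriv r)) (@measurable_itv R `[0, 1]).
rewrite -ge0_integralD //; [|exact: mf|exact: mf].
apply: ge0_le_integral => //.
- exact: mf.
- by apply: emeasurable_funD; exact: mf.
- by move=> x _; rewrite -EFinD lee_fin derivD hornerD ler_normD.
Qed.

Lemma tvarZ (R : realType) (a : R) (p : {poly R}) : tvar (a *: p) = `|a| * tvar p.
Proof.
have [_ Ep] := tvarE p; have [_ Eap] := tvarE (a *: p).
move: (tvar p) (tvar (a *: p)) Ep Eap => b c Ep Eap.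
apply: EFin_inj; rewrite EFinM -Ep -Eap.
rewrite -ge0_integralZl //.
  by apply: eq_integral => x _; rewrite -EFinM derivZ hornerZ normrM.
exact: measurable_EFin_norm (@continuous_horner _ _) _.
Qed.

Lemma endpoint_le_tvar (R : realType) (p : {poly R}) : p.[0] = 0 -> `|p.[1]| <= tvar p.
Proof.
move=> p0.
have cd := @continuous_horner _ (deriv p).
have cp := @continuous_horner _ p.
have ftc : (\int[@lebesgue_measure R]_(x in `[0%R, 1%R]) (deriv p).[x]%:E)%E = p.[1]%:E.
  rewrite (@continuous_FTC2 _ _ (horner p)) ?p0 ?sube0 //.
  - exact: continuous_subspaceT.
  - split; [by move=> x _; exact: derivable_horner| |].
    + exact: cvg_at_right_filter (cp 0).
    + exact: cvg_at_left_filter (cp 1).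
  - by move=> x _; rewrite derivE.
have [_ Ep] := tvarE p; move: (tvar p) Ep => v Ep.
rewrite -lee_fin -Ep -[(`|_|)%:E]/(`|p.[1]%:E|%E) -ftc.
apply: le_abse_integral => //; apply/measurable_EFinP; apply: measurable_funTS.
exact: continuous_measurable_fun.
Qed.

(** * The extremal quotients *)

(** The leading coefficient of [q], times a positive integer, survives. *)
Lemma deriv_XnM_neq0 (R : numDomainType) (n : nat) (q : {poly R}) :
  q != 0 -> deriv ('X^(n.+1) * q) != 0.
Proof.
move=> q0; apply/negP => /eqP/(congr1 (fun r : {poly R} => r`_(n + (size q).-1))).
rewrite coef_deriv coef0 coefXnM -addSn ltnNge leq_addr /= addKn => /eqP.
by rewrite mulrn_eq0 /= -/(lead_coef q) lead_coef_eq0 (negPf q0).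
Qed.

Lemma EFin_div_pos (R : realType) (x y : R) : 0 < y -> (x%:E / y%:E)%E = (x / y)%:E.
Proof. by move=> y0; rewrite inver gt_eqF // -EFinM. Qed.

(** Covers [y = 0], where the quotient is [+oo]. *)
Lemma lee_EFin_div (R : realType) (b x y : R) : 0 < x -> 0 <= y -> b * y <= x ->
  (b%:E <= x%:E / y%:E)%E.
Proof.
move=> x0; rewrite le_eqVlt => /predU1P[<- _|y0 byx].
  by rewrite inver eqxx gt0_muley ?lte_fin // leey.
by rewrite EFin_div_pos // lee_fin ler_pdivlMr.
Qed.

Lemma polys_zero_at_0P (R : realType) (n k : nat) (p : {poly R}) :
  @polys_zero_at_0 R n k p ->
  [/\ 0 < wnorm p, p.[0] = 0 &
    (0 < k)%N -> exists2 q : {poly R}, (size q <= k)%N & p = 'X^(n.+1) * q].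
Proof.
move=> [q [sq q0 ->]]; split.
- exact/wnorm_gt0/deriv_XnM_neq0.
- by rewrite hornerM hornerXn expr0n mul0r.
- by move=> k0; exists q => //; rewrite -(prednK k0).
Qed.

(** A maximiser of [W / wnorm] minimises the quotient. A point where [W] is positive
    keeps the minimum finite. *)
Lemma extremal_quotient (R : realType) (n k : nat) (W : {poly R} -> R) : (0 < k)%N ->
  (forall p q, W (p + q) <= W p + W q) -> (forall a p, W (a *: p) = `|a| * W p) ->
  (exists2 p, @polys_zero_at_0 R n k p & 0 < W p) ->
  exists2 p, @polys_zero_at_0 R n k p & 0 < W p /\
    is_min [set (weighted_deriv_norm p / (W p)%:E)%E | p in @polys_zero_at_0 R n k]
      (wnorm p / W p)%:E.
Proof.
case: k => // m _ Wtri WZ [p1 [q1 [sq1 q10 ->]] Wp1].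
have W0 p : 0 <= W p.
  have := Wtri p (- p); rewrite subrr -(scale0r (0 : {poly R})) -scaleN1r !WZ normrN1 normr0; lra.
pose P (v : 'rV[R]_m.+1) : {poly R} := 'X^(n.+1) * rVpoly v.
have PD u v : P (u + v) = P u + P v by rewrite /P linearD mulrDr.
have PZ a u : P (a *: u) = a *: P u by rewrite /P linearZ -scalerAr.
have PA v : v != 0 -> @polys_zero_at_0 R n m.+1 (P v).
  move=> v0; exists (rVpoly v); split => //; first exact: size_poly.
  by apply: contra_neq v0 => h; rewrite -(rVpolyK v) h linear0.
have triP (F : {poly R} -> R) : (forall p q, F (p + q) <= F p + F q) ->
    forall u v, F (P (u + v)) <= F (P u) + F (P v) by move=> h u v; rewrite PD.
have homP (F : {poly R} -> R) : (forall a p, F (a *: p) = `|a| * F p) ->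
    forall a u, F (P (a *: u)) = `|a| * F (P u) by move=> h a u; rewrite PZ.
have NP v : v != 0 -> 0 < wnorm (P v) by move=> /PA/polys_zero_at_0P[].
have [v v0 vmax] := seminorm_ratio_max (triP _ (@wnormD R)) (homP _ (@wnormZ R)) NP
  (triP _ Wtri) (homP _ WZ).
have opt p : @polys_zero_at_0 R n m.+1 p -> W p * wnorm (P v) <= W (P v) * wnorm p.
  by move=> [q [sq q0 ->]]; have := vmax (poly_rV q); rewrite /= /P poly_rV_K.
have [Nv _ _] := polys_zero_at_0P (PA v v0).
have Wv : 0 < W (P v).
  rewrite lt0r W0 andbT; apply: contraTneq Wp1 => h.
  have A1 : @polys_zero_at_0 R n m.+1 ('X^(n.+1) * q1) by exists q1.
  have := opt _ A1; rewrite h mul0r pmulr_lle0 // => /le_lt_trans h'.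
  by apply/negP => /h'; rewrite ltxx.
exists (P v); [exact: PA|split => //; split].
  exists (P v); first exact: PA.
  by have [-> _ _] := wnormP (P v); rewrite EFin_div_pos.
move=> _ [p Ap <-]; have [-> _ _] := wnormP p; have [Np _ _] := polys_zero_at_0P Ap.
apply: lee_EFin_div => //; rewrite mulrAC ler_pdivrMr // mulrC [leRHS]mulrC.
exact: opt.
Qed.

Lemma wnorm_ge_tvar (R : realType) (n k : nat) (p : {poly R}) :
  (0 < n)%N -> (0 < k)%N -> @polys_zero_at_0 R n k p ->
  1 / 6 * Num.sqrt (n%:R / k%:R) * tvar p <= wnorm p.
Proof.
move=> n0 k0 /polys_zero_at_0P[_ _ /(_ k0)[q sq ->]].
have [_ Hp _] := wnormP ('X^(n.+1) * q); have [_ Ep] := tvarE ('X^(n.+1) * q).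
have := variation_le n0 k0 sq Hp.
move: (tvar _) (wnorm _) Ep {Hp} => v w ->; rewrite lee_fin => vw.
have nk1 : Num.sqrt (n%:R / k%:R) * Num.sqrt (k%:R / n%:R) = 1 :> R.
  rewrite -sqrtrM ?divr_ge0 // mulrA divfK ?divff ?sqrtr1 // pnatr_eq0 -lt0n //.
have := ler_wpM2l (sqrtr_ge0 (n%:R / k%:R : R)) vw.
rewrite mulrA mulrCA nk1; lra.
Qed.

(** For [k > n] the polynomial is the one for [k = n], where [n/k + 1] is replaced
    by 2; this costs the factor [sqrt 2] between [sqrt 8] and 4. *)
Lemma endpoint_upper_bound (R : realType) (n k : nat) : (0 < n)%N -> (0 < k)%N ->
  exists e : {poly R}, [/\ @polys_zero_at_0 R n k e, 0 < `|e.[1]| &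
    wnorm e <= 4 * Num.sqrt (n%:R / k%:R + 1) * `|e.[1]|].
Proof.
move=> n0 k0; pose k' := minn n k; have k'0 : (0 < k')%N by rewrite leq_min n0.
have [q [sq q1 qle]] := @endpoint_extremal R n k' k'0 (geq_minl _ _).
have kr0 : 0 < k%:R :> R by rewrite ltr0n.
have nr0 : 0 < n%:R :> R by rewrite ltr0n.
have nk0 : 0 <= n%:R / k%:R :> R by rewrite divr_ge0.
exists ('X^(n.+1) * q).
have -> : ('X^(n.+1) * q).[1] = q.[1] by rewrite hornerM hornerXn expr1n mul1r.
rewrite gtr0_norm //; split => //.
  exists q; split => //; last by apply: contraTneq q1 => ->; rewrite horner0 ltxx.
  by rewrite /polys_deg_le /= prednK // (leq_trans sq) // geq_minr.
have [_ _ [c c01 ->]] := wnormP ('X^(n.+1) * q).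
apply: le_trans (qle c c01) _; rewrite ler_wpM2r ?(ltW q1) //.
have -> : 4 = Num.sqrt 16 :> R.
  by rewrite (_ : 16 = 4 ^+ 2) ?sqrtr_sqr ?ger0_norm //; ring.
rewrite -sqrtrM // ler_wsqrtr //.
have [nk|kn] := leqP n k.
  by rewrite /k' (minn_idPl nk) divff ?lt0r_neq0 //; lra.
by rewrite /k' (minn_idPr (ltnW kn)); lra.
Qed.

Theorem theorem2p2 (R : realType) :
  exists c1 c2 : R,
    [/\ 0 < c1, 0 < c2, c1 = 1 / 6 &
      forall n k : nat, (1 <= n)%N -> (1 <= k)%N ->
        exists m1 m2 : \bar R,
          [/\ is_min (@variation_quotients R n k) m1,
              is_min (@endpoint_quotients R n k) m2,
              ((c1 * Num.sqrt (n%:R / k%:R))%:E <= m1)%E,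
              (m1 <= m2)%E &
              (m2 <= (c2 * Num.sqrt (n%:R / k%:R + 1))%:E)%E]].
Proof.
exists (1 / 6), 4; split => // n k n0 k0.
have [e [Ae e1 ele]] := endpoint_upper_bound R n0 k0.
have end_le p : @polys_zero_at_0 R n k p -> `|p.[1]| <= tvar p.
  by case/polys_zero_at_0P => _ p0 _; exact: endpoint_le_tvar.
have Ve : 0 < tvar e by apply: lt_le_trans e1 (end_le e Ae).
have [p1 Ap1 [Vp1 m1min]] := extremal_quotient k0 (@tvarD R) (@tvarZ R)
  (ex_intro2 _ _ e Ae Ve).
have ev1D (p r : {poly R}) : `|(p + r).[1]| <= `|p.[1]| + `|r.[1]|.
  by rewrite hornerD ler_normD.
have ev1Z a (p : {poly R}) : `|(a *: p).[1]| = `|a| * `|p.[1]| by rewrite hornerZ normrM.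
have [p2 Ap2 [Vp2 m2min]] := @extremal_quotient R n k (fun p => `|p.[1]|) k0 ev1D ev1Z
  (ex_intro2 _ _ e Ae e1).
have variation_quotientsE : @variation_quotients R n k =
    [set (weighted_deriv_norm p / (tvar p)%:E)%E | p in @polys_zero_at_0 R n k].
  by apply: eq_imagel => p _; have [-> _] := tvarE p.
exists (wnorm p1 / tvar p1)%:E, (wnorm p2 / `|p2.[1]|)%:E; split.
- by rewrite variation_quotientsE.
- exact: m2min.
- by rewrite lee_fin ler_pdivlMr // wnorm_ge_tvar.
- have Np2 : 0 < wnorm p2 by case/polys_zero_at_0P: Ap2.
  have Vp2' : 0 < tvar p2 by exact: lt_le_trans Vp2 (end_le _ Ap2).
  apply: le_trans (m1min.2 (wnorm p2 / tvar p2)%:E _) _.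
    by exists p2 => //; have [-> _ _] := wnormP p2; rewrite EFin_div_pos.
  move: (wnorm p2) `|p2.[1]| (tvar p2) Np2 Vp2 Vp2' (end_le p2 Ap2) => w y v w0 y0 v0 yv.
  by rewrite lee_fin ler_wpM2l ?lef_pV2 ?posrE // ltW.
- apply: le_trans (m2min.2 (wnorm e / `|e.[1]|)%:E _) _.
    by exists e => //; have [-> _ _] := wnormP e; rewrite EFin_div_pos.
  by rewrite lee_fin ler_pdivrMr.
Qed.
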